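(* Let $z\in X_d$ and $r:=-(A\nabla z+bz+g_2)$. Then $z$ satisfies the adjoint weak problem $$a(s_0,z)=m(s_0)\qquad\forall s_0\in H_D^1(\Omega)$$ if and only if $(r,z)$ satisfies the adjoint first-order system $$\nabla\cdot r+cz=g_1\ \text{in }\Omega,\qquad r+A\nabla z+bz=-g_2\ \text{in }\Omega,\qquad z=\phi_d\ \text{on }\Gamma_D,\qquad r\cdot n=\psi_d\ \text{on }\Gamma_N.$$
   Context: $\Omega\subset\mathbb R^d$, $d\ge2$, is a bounded Lipschitz domain with outward unit normal $n$ and $\partial\Omega=\overline{\Gamma_D}\cup\overline{\Gamma_N}$, where $\Gamma_D,\Gamma_N$ are disjoint relatively open subsets of $\partial\Omega$ and $|\Gamma_D|>0$. $A\in L^\infty(\Omega;\mathbb R^{d\times d})$ is symmetric with $a_0|\xi|^2\le\xi^TA(x)\xi\le a_1|\xi|^2$ for all $\xi\in\mathbb R^d$ and a.e. $x$, where $0<a_0\le a_1<\infty$; $b\in L^\infty(\Omega)^d$, $c\in L^\infty(\Omega)$. Data: $g_1\in L^2(\Omega)$, $g_2\in L^2(\Omega)^d$, $\psi_d\in L^2(\Gamma_N)$, $\phi_d\in H^{1/2}(\Gamma_D)$ (restrictions to $\Gamma_D$ of $H^{1/2}(\partial\Omega)$ functions). $(\cdot,\cdot)$ is the $L^2(\Omega)$ inner product, $\langle\cdot,\cdot\rangle_{\Gamma_N}$ the $L^2(\Gamma_N)$ pairing of traces; $H_D^1(\Omega)=\{v\in H^1(\Omega):v=0\text{ on }\Gamma_D\}$,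 $X_d=\{v\in H^1(\Omega):v=\phi_d\text{ on }\Gamma_D\}$. For $t,s,w\in H^1(\Omega)$, $a(t,s)=(A\nabla t,\nabla s)+(b\cdot\nabla t+ct,s)$ and $m(w)=(g_1,w)-(g_2,\nabla w)-\langle\psi_d,w\rangle_{\Gamma_N}$. Standing assumption (inf-sup): there is $\beta>0$ with $\beta=\inf_{0\ne w_0\in H_D^1(\Omega)}\sup_{0\ne v_0\in H_D^1(\Omega)}\frac{a(w_0,v_0)}{\|w_0\|_1\|v_0\|_1}=\inf_{0\ne v_0\in H_D^1(\Omega)}\sup_{0\ne w_0\in H_D^1(\Omega)}\frac{a(w_0,v_0)}{\|w_0\|_1\|v_0\|_1}$, where $\|\cdot\|_1$ is the $H^1(\Omega)$ norm. In the first-order system the divergence is the weak divergence (so that $r\in H(\mathrm{div};\Omega)$), and $r\cdot n=\psi_d$ on $\Gamma_N$ is understood in the normal-trace sense: $\langle r\cdot n,s_0\rangle_{\partial\Omega}:=(r,\nabla s_0)+(\nabla\cdot r,s_0)=\langle\psi_d,s_0\rangle_{\Gamma_N}$ for all $s_0\in H_D^1(\Omega)$. *)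

(* Defs.v *)
From HB Require Import structures.
From mathcomp Require Import all_boot all_order all_algebra.
From mathcomp Require Import all_classical all_reals all_analysis.

Set Implicit Arguments.
Unset Strict Implicit.
Unset Printing Implicit Defensive.
Import Order.TTheory GRing.Theory Num.Def Num.Theory.
Import numFieldNormedType.Exports.

Local Open Scope classical_set_scope.
Local Open Scope ring_scope.

(* The library norm `|x| on matrices is the sup norm, hence [enorm]. *)
Definition dotv (R : realType) (d : nat) (u v : 'cV[R]_d) : R :=
  \sum_(i < d) u i 0 * v i 0.

Definition enorm (R : realType) (d : nat) (u : 'cV[R]_d) : R :=
  Num.sqrt (dotv u u).

(* [cover_measure zeta X] is the infimum of \sum_k zeta (S k) over all
   countable covers S of X; the alias makes every subset of T available to the
   library's [mu_ext], and the value of zeta at the empty set is reset to 0. *)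
Definition all_sets (T : Type) : Type := T.

Section all_sets.
Variable T : pointedType.

HB.instance Definition _ := Pointed.on (all_sets T).
HB.instance Definition _ := @isMeasurable.Build default_measure_display
  (all_sets T) discrete_measurable (@discrete_measurable0 _)
  (@discrete_measurableC _) (@discrete_measurableU _).

End all_sets.

Section cover_measure.
Local Open Scope ereal_scope.
Context (R : realType) (T : pointedType).
Implicit Types (zeta : set T -> \bar R) (X : set T).

Definition gauge0 zeta X : \bar R := if `[< X = set0 >] then 0 else zeta X.

Definition cover_measure zeta X : \bar R :=
  @mu_ext _ (all_sets T) R (gauge0 zeta) X.

Lemma gauge0_set0 zeta : gauge0 zeta set0 = 0.
Proof. by rewrite /gauge0; case: ifPn => // /asboolP. Qed.

Lemma gauge0_ge0 zeta : (forall X, X !=set0 -> 0 <= zeta X) ->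
  forall X, 0 <= gauge0 zeta X.
Proof.
move=> z0 X; rewrite /gauge0; case: ifPn => // /asboolP/eqP/set0P.
exact: z0.
Qed.

Section theory.
Variable zeta : set T -> \bar R.
Hypothesis zeta_ge0 : forall X, X !=set0 -> 0 <= zeta X.

Lemma cover_measure0 : cover_measure zeta set0 = 0.
Proof. exact/mu_ext0/gauge0_ge0/zeta_ge0/gauge0_set0. Qed.

Lemma cover_measure_ge0 X : 0 <= cover_measure zeta X.
Proof. exact/mu_ext_ge0/gauge0_ge0/zeta_ge0. Qed.

Lemma le_cover_measure :
  {homo cover_measure zeta : A B / A `<=` B >-> A <= B}.
Proof. by move=> A B; exact: (@le_mu_ext _ (all_sets T)). Qed.

Lemma cover_measure_sigma_subadditive :
  sigma_subadditive (cover_measure zeta).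
Proof.
move=> F; apply: (@mu_ext_sigma_subadditive _ (all_sets T)).
exact/gauge0_ge0/zeta_ge0.
Qed.

End theory.
End cover_measure.

Section lebesgue_Rd.
Local Open Scope ereal_scope.
Context (R : realType) (d : nat).
Implicit Types (X : set 'cV[R]_d).

(* least volume of a compact box containing X (+oo if X is unbounded) *)
Definition box_gauge X : \bar R :=
  ereal_inf [set (\prod_(i < d) (ab.2 i 0 - ab.1 i 0)%R)%:E | ab in
    [set ab : 'cV[R]_d * 'cV[R]_d |
      (forall i, (ab.1 i 0 <= ab.2 i 0)%R) /\
      X `<=` [set x | forall i, (ab.1 i 0 <= x i 0 <= ab.2 i 0)%R]]].

Definition leb_outer : set 'cV[R]_d -> \bar R := cover_measure box_gauge.

Lemma box_gauge_ge0 X : X !=set0 -> 0 <= box_gauge X.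
Proof.
move=> _; apply: le_ereal_inf_tmp => _ [ab [ab_le _] <-].
by rewrite lee_fin; apply: prodr_ge0 => i _; rewrite subr_ge0.
Qed.

HB.instance Definition _ := isOuterMeasure.Build R 'cV[R]_d leb_outer
  (cover_measure0 box_gauge_ge0) (cover_measure_ge0 box_gauge_ge0)
  (@le_cover_measure _ _ box_gauge)
  (cover_measure_sigma_subadditive box_gauge_ge0).

(* d-dimensional Lebesgue measure, on the Lebesgue (Caratheodory) sets *)
Definition leb : set (caratheodory_type leb_outer) -> \bar R :=
  leb_outer.

HB.instance Definition _ := isMeasure.Build _ _ _ leb
  (@caratheodory_measure0 _ _ leb_outer)
  (@caratheodory_measure_ge0 _ _ leb_outer)
  (@caratheodory_measure_sigma_additive _ _ leb_outer).

End lebesgue_Rd.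
Arguments leb : clear implicits.

Section hausdorff.
Local Open Scope ereal_scope.
Context (R : realType) (d m : nat).
Implicit Types (X : set 'cV[R]_d) (delta : R).

Definition ediam X : \bar R :=
  ereal_sup [set (enorm (xy.1 - xy.2))%:E | xy in X `*` X].

(* volume of the unit ball of R^m, so that the m-dimensional Hausdorff measure
   below is the m-dimensional surface area *)
Definition ball_volume : R :=
  fine (leb_outer [set x : 'cV[R]_m | (enorm x <= 1)%R]).

Definition diam_gauge delta X : \bar R :=
  if ediam X <= delta%:E
  then (ball_volume * (fine (ediam X) / 2) ^+ m)%R%:E else +oo.

Definition hausdorff_outer X : \bar R :=
  ereal_sup [set cover_measure (diam_gauge delta) X | delta in
    [set delta | (0 < delta)%R]].

Lemma diam_gauge_ge0 delta X : X !=set0 -> 0 <= diam_gauge delta X.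
Proof.
move=> [x Xx]; rewrite /diam_gauge; case: ifPn => // _.
rewrite lee_fin mulr_ge0 ?fine_ge0 ?outer_measure_ge0// exprn_ge0// divr_ge0//.
apply: fine_ge0; apply: ereal_sup_ubound; exists (x, x) => //=.
rewrite subrr /enorm /dotv big1 ?sqrtr0// => i _.
by rewrite mxE mul0r.
Qed.

Lemma hausdorff_outer_ge0 X : 0 <= hausdorff_outer X.
Proof.
apply: (@le_trans _ _ (cover_measure (diam_gauge 1) X)); last first.
  by apply: ereal_sup_ubound; exists 1%R => /=.
by apply: cover_measure_ge0; exact: diam_gauge_ge0.
Qed.

Lemma hausdorff_outer0 : hausdorff_outer set0 = 0.
Proof.
apply/eqP; rewrite eq_le hausdorff_outer_ge0 andbT.
apply: ge_ereal_sup => _ [delta _ <-].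
by rewrite cover_measure0//; exact: diam_gauge_ge0.
Qed.

Lemma le_hausdorff_outer :
  {homo hausdorff_outer : A B / A `<=` B >-> A <= B}.
Proof.
move=> A B AB; apply: ge_ereal_sup => _ [delta delta0 <-].
apply: (@le_trans _ _ (cover_measure (diam_gauge delta) B)); last first.
  by apply: ereal_sup_ubound; exists delta.
exact: le_cover_measure.
Qed.

Lemma hausdorff_outer_sigma_subadditive : sigma_subadditive hausdorff_outer.
Proof.
move=> F; apply: ge_ereal_sup => _ [delta delta0 <-].
apply: le_trans (cover_measure_sigma_subadditive (diam_gauge_ge0 delta) F) _.
apply: lee_nneseries => [i _|i _ /=].
  by move=> _; apply: cover_measure_ge0; exact: diam_gauge_ge0.
by apply: ereal_sup_ubound; exists delta.
Qed.

HB.instance Definition _ := isOuterMeasure.Build R 'cV[R]_d hausdorff_outer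
  hausdorff_outer0 hausdorff_outer_ge0 le_hausdorff_outer
  hausdorff_outer_sigma_subadditive.

Definition hausdorff : set (caratheodory_type hausdorff_outer) -> \bar R :=
  hausdorff_outer.

HB.instance Definition _ := isMeasure.Build _ _ _ hausdorff
  (@caratheodory_measure0 _ _ hausdorff_outer)
  (@caratheodory_measure_ge0 _ _ hausdorff_outer)
  (@caratheodory_measure_sigma_additive _ _ hausdorff_outer).

End hausdorff.
Arguments ball_volume : clear implicits.
Arguments hausdorff : clear implicits.

Notation surf R d := (hausdorff R d d.-1).

Section domains.
Context (R : realType) (d : nat).
Implicit Types (Omega : set 'cV[R]_d).

Definition boundary Omega : set 'cV[R]_d := closure Omega `\` interior Omega.

(* Near each boundary point, Omega is the region lying strictly above the graph
   of a Lipschitz function over a hyperplane; e is the upward unit normal of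
   this hyperplane, and gamma is only used at points orthogonal to e. *)
Definition bounded_lipschitz_domain Omega : Prop :=
  [/\ open Omega, connected Omega, bounded_set Omega &
    forall p, boundary Omega p ->
      exists (e : 'cV[R]_d) (gamma : 'cV[R]_d -> R),
        [/\ enorm e = 1, lipschitz gamma &
          \forall x \near p,
            Omega x <-> gamma (x - dotv x e *: e) < dotv x e]].

Definition relatively_open_in (S G : set 'cV[R]_d) : Prop :=
  exists2 U : set 'cV[R]_d, open U & G = S `&` U.

Definition boundary_partition Omega (GammaD GammaN : set 'cV[R]_d) : Prop :=
  [/\ relatively_open_in (boundary Omega) GammaD,
      relatively_open_in (boundary Omega) GammaN,
      GammaD `&` GammaN = set0 &
      boundary Omega = closure GammaD `|` closure GammaN].

End domains.

(* f is extended by 0 outside D, so its values there are irrelevant *)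
Definition Lp_on (disp : measure_display) (T : measurableType disp)
    (R : realType) (mu : {measure set T -> \bar R}) (p : \bar R) (D : set T)
    (f : T -> R) : Prop :=
  f \_ D \in Lfun mu p.

Section sobolev.
Context (R : realType) (d : nat).
Implicit Types (Omega : set 'cV[R]_d) (u v : 'cV[R]_d -> R).

Definition partial (i : 'I_d) u : 'cV[R]_d -> R :=
  fun x => 'D_(delta_mx i 0) u x.

Definition gradient u : 'cV[R]_d -> 'cV[R]_d := fun x => \col_i partial i u x.

Fixpoint C_k (k : nat) u : Prop :=
  if k is k'.+1 then
    continuous u /\ forall i : 'I_d,
      (forall x, derivable u x (delta_mx i 0)) /\ C_k k' (partial i u)
  else continuous u.

Definition smooth u : Prop := forall k, C_k k u.

Definition test_function Omega u : Prop :=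
  [/\ smooth u, compact (closure [set x | u x != 0]) &
      closure [set x | u x != 0] `<=` Omega].

Definition L2_scalar Omega u : Prop := Lp_on (leb R d) 2%:E Omega u.

Definition L2_vector Omega (q : 'cV[R]_d -> 'cV[R]_d) : Prop :=
  forall i, L2_scalar Omega (fun x => q x i 0).

Definition Linf_scalar Omega u : Prop := Lp_on (leb R d) +oo%E Omega u.

Definition weak_gradient Omega u (g : 'cV[R]_d -> 'cV[R]_d) : Prop :=
  forall phi, test_function Omega phi -> forall i,
    \int[leb R d]_(x in Omega) (u x * partial i phi x) =
    - \int[leb R d]_(x in Omega) (g x i 0 * phi x).

(* r is in H(div; Omega), with weak divergence q *)
Definition weak_divergence Omega (r : 'cV[R]_d -> 'cV[R]_d) q : Prop :=
  [/\ L2_vector Omega r, L2_scalar Omega q &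
    forall phi, test_function Omega phi ->
      \int[leb R d]_(x in Omega) dotv (r x) (gradient phi x) =
      - \int[leb R d]_(x in Omega) (q x * phi x)].

(* A representative of an element of H^1(Omega), with a representative of its
   weak gradient. *)
Record H1 Omega := MkH1 {
  fval : 'cV[R]_d -> R;
  fgrad : 'cV[R]_d -> 'cV[R]_d;
  H1_L2 : L2_scalar Omega fval;
  H1_gradL2 : L2_vector Omega fgrad;
  H1_weak : weak_gradient Omega fval fgrad }.

Definition H1_norm Omega (u : H1 Omega) : R :=
  Num.sqrt (\int[leb R d]_(x in Omega)
    (fval u x ^+ 2 + dotv (fgrad u x) (fgrad u x))).

(* Graph of the trace operator H^1(Omega) -> L^2(boundary Omega): on a Lipschitz
   domain this operator is the continuous extension of u |-> u|_boundary from
   the smooth functions on R^d, whose restrictions are dense in H^1(Omega). *)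
Definition is_trace Omega (v : H1 Omega) (w : 'cV[R]_d -> R) : Prop :=
  Lp_on (surf R d) 2%:E (boundary Omega) w /\
  exists u : nat -> 'cV[R]_d -> R,
    [/\ forall n, smooth (u n),
        (fun n => \int[leb R d]_(x in Omega)
           ((u n x - fval v x) ^+ 2 +
            dotv (gradient (u n) x - fgrad v x)
                 (gradient (u n) x - fgrad v x))%:E)%E @ \oo --> 0%E &
        (fun n => \int[surf R d]_(x in boundary Omega)
           ((u n x - w x) ^+ 2)%:E)%E @ \oo --> 0%E].

(* An element of H^1(Omega) together with its trace.  By the trace theorem every
   element of H^1 of a bounded Lipschitz domain has exactly one trace, up to
   surface-null sets, so these are again the elements of H^1(Omega). *)
Record H1t Omega := MkH1t {
  H1t_H1 :> H1 Omega;
  trace : 'cV[R]_d -> R;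
  H1t_trace : is_trace H1t_H1 trace }.

Definition trace_eq Omega (G : set 'cV[R]_d) (v : H1t Omega)
    (w : 'cV[R]_d -> R) : Prop :=
  trace v = w %[ae surf R d in G].

Definition H1_D Omega (GammaD : set 'cV[R]_d) (v : H1t Omega) : Prop :=
  trace_eq GammaD v (cst 0).

(* If u = 0 a.e. then its weak gradient vanishes a.e. too, so this is u <> 0 in
   H^1(Omega). *)
Definition H1_neq0 Omega (u : H1 Omega) : Prop :=
  ~ (fval u = cst 0 %[ae leb R d in Omega]).

(* H^{1/2}(boundary Omega), with the Sobolev-Slobodeckij seminorm; the exponent
   d is (d - 1) + 2 * (1/2). *)
Definition Hhalf_boundary Omega (w : 'cV[R]_d -> R) : Prop :=
  Lp_on (surf R d) 2%:E (boundary Omega) w /\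
  (\int[surf R d]_(x in boundary Omega) \int[surf R d]_(y in boundary Omega)
     (((w x - w y) ^+ 2) / enorm (x - y) ^+ d)%:E < +oo)%E.

Definition Hhalf Omega (G : set 'cV[R]_d) (phi : 'cV[R]_d -> R) : Prop :=
  exists2 w, Hhalf_boundary Omega w & phi = w %[ae surf R d in G].

End sobolev.

Section problem.
Context (R : realType) (d : nat) (Omega : set 'cV[R]_d).
Variables (A : 'cV[R]_d -> 'M[R]_d) (b : 'cV[R]_d -> 'cV[R]_d)
  (c : 'cV[R]_d -> R).

Definition elliptic_coefficient (a0 a1 : R) : Prop :=
  [/\ forall i j, Linf_scalar Omega (fun x => A x i j),
      \forall x \ae leb R d, Omega x -> (A x)^T = A x &
      \forall x \ae leb R d, Omega x -> forall xi : 'cV[R]_d,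
        a0 * enorm xi ^+ 2 <= (xi^T *m A x *m xi) 0 0 <= a1 * enorm xi ^+ 2].

Definition form_a (t s : H1 Omega) : R :=
  \int[leb R d]_(x in Omega) dotv (A x *m fgrad t x) (fgrad s x) +
  \int[leb R d]_(x in Omega)
    ((dotv (b x) (fgrad t x) + c x * fval t x) * fval s x).

(* The infimum is over the first, resp. second, argument of a. *)
Definition infsup_fst (GammaD : set 'cV[R]_d) : \bar R :=
  ereal_inf [set ereal_sup
      [set (form_a w v / (H1_norm w * H1_norm v))%:E |
         v in [set v : H1t Omega | H1_D GammaD v /\ H1_neq0 v]] |
    w in [set w : H1t Omega | H1_D GammaD w /\ H1_neq0 w]].

Definition infsup_snd (GammaD : set 'cV[R]_d) : \bar R :=
  ereal_inf [set ereal_sup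
      [set (form_a w v / (H1_norm w * H1_norm v))%:E |
         w in [set w : H1t Omega | H1_D GammaD w /\ H1_neq0 w]] |
    v in [set v : H1t Omega | H1_D GammaD v /\ H1_neq0 v]].

Variables (GammaD GammaN : set 'cV[R]_d) (g1 : 'cV[R]_d -> R)
  (g2 : 'cV[R]_d -> 'cV[R]_d) (psid phid : 'cV[R]_d -> R).

Definition form_m (w : H1t Omega) : R :=
  \int[leb R d]_(x in Omega) (g1 x * fval w x) -
  \int[leb R d]_(x in Omega) dotv (g2 x) (fgrad w x) -
  \int[surf R d]_(x in GammaN) (psid x * trace w x).

Definition adjoint_weak_problem (z : H1t Omega) : Prop :=
  forall s0 : H1t Omega, H1_D GammaD s0 -> form_a s0 z = form_m s0.

Definition adjoint_flux (z : H1 Omega) : 'cV[R]_d -> 'cV[R]_d :=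
  fun x => - (A x *m fgrad z x + fval z x *: b x + g2 x).

(* q is the weak divergence of r; the last clause is the normal trace condition
   on GammaN, <r.n, s0>_{boundary Omega} being (r, grad s0) + (q, s0). *)
Definition adjoint_first_order_system (r : 'cV[R]_d -> 'cV[R]_d)
    (z : H1t Omega) : Prop :=
  exists q : 'cV[R]_d -> R, weak_divergence Omega r q /\
    [/\ (fun x => q x + c x * fval z x) = g1 %[ae leb R d in Omega],
        (fun x => r x + A x *m fgrad z x + fval z x *: b x) = (fun x => - g2 x)
          %[ae leb R d in Omega],
        trace_eq GammaD z phid &
        forall s0 : H1t Omega, H1_D GammaD s0 ->
          \int[leb R d]_(x in Omega) dotv (r x) (fgrad s0 x) +
          \int[leb R d]_(x in Omega) (q x * fval s0 x) =
          \int[surf R d]_(x in GammaN) (psid x * trace s0 x)].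

End problem.

(* Main.v *)
(** As [A] is symmetric a.e., every [s] in [H^1] and every [q] with
    [q + c z = g1] a.e. satisfy
    [(r, grad s) + (q, s) = (g1, s) - (g2, grad s) - a(s, z)]; hence the normal
    trace condition on [GammaN] and the weak problem are the same statement.
    What remains is that [q := g1 - c z] is the weak divergence of [r], which is
    the weak problem tested against smooth functions with compact support in
    [Omega].  These have to be seen as elements of [H^1] with zero trace, so
    they must satisfy integration by parts.  As [leb] comes from coverings by
    boxes, this is derived from its translation invariance: the integral of
    [D_v f] is the limit of the integrals of the difference quotients of [f],
    all of which vanish. *)

Require Import Defs.
From HB Require Import structures.
From mathcomp Require Import all_boot all_order all_algebra.
From mathcomp Require Import all_classical all_reals all_analysis.
From mathcomp Require Import ess_sup_inf measurable_realfun ring lra.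

Import Order.TTheory GRing.Theory Num.Def Num.Theory.
Import numFieldNormedType.Exports.

Local Open Scope classical_set_scope.
Local Open Scope ring_scope.

(** * Square-integrable functions on a measurable set *)

Section Lp_on_theory.
Set Implicit Arguments.
Unset Strict Implicit.
Context (disp : measure_display) (T : measurableType disp) (R : realType)
  (mu : {measure set T -> \bar R}) (D : set T) (mD : measurable D).
Implicit Types f g : T -> R.

Lemma Lp_on_measurable (p : \bar R) f : Lp_on mu p D f -> measurable_fun D f.
Proof.
rewrite /Lp_on inE => /andP[/[!inE]/= mf _].
exact/(measurable_restrictT _ mD).
Qed.

(** Squaring commutes with extension by 0, since [0 ^+ 2 = 0]; this turns membership of the extended
    function into conditions on [D] alone. *)
Lemma Lp_on2P f : Lp_on mu 2%:E D f <->
  measurable_fun D f /\ mu.-integrable D (EFin \o (fun x => f x ^+ 2)).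
Proof.
have E : EFin \o (fun x => (f \_ D) x ^+ 2) =
    (EFin \o (fun x => f x ^+ 2)) \_ D.
  apply/funext => x; rewrite /= !patchE; case: ifPn => //= _.
  by rewrite expr0n.
split=> [fL2|[mf /(integrable_mkcond _ mD)]].
  split; first exact: Lp_on_measurable fL2.
  apply/(integrable_mkcond _ mD); rewrite -E.
  exact: Lfun2_integrable_sqr.
rewrite -E => /integrableP[_ fi].
rewrite /Lp_on inE; apply/andP; split; rewrite inE/=.
  exact/(measurable_restrictT _ mD).
rewrite /finite_norm unlock /Lnorm poweR_lty//.
apply: le_lt_trans fi; rewrite le_eqVlt; apply/orP; left; apply/eqP.
apply: eq_integral => x _ /=.
by rewrite powR_mulrn// normrX.
Qed.

Lemma Lp_on2_mul_integrable f g : Lp_on mu 2%:E D f -> Lp_on mu 2%:E D g ->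
  mu.-integrable D (EFin \o (fun x => f x * g x)).
Proof.
move=> fL2 gL2; apply/(integrable_mkcond _ mD).
have /Lfun1_integrable := Lfun2_mul_Lfun1 fL2 gL2.
congr (_.-integrable _ _); apply/funext => x.
by rewrite /= !patchE; case: ifPn => //= _; rewrite mul0r.
Qed.

Lemma Lp_on2D f g : Lp_on mu 2%:E D f -> Lp_on mu 2%:E D g ->
  Lp_on mu 2%:E D (fun x => f x + g x).
Proof.
rewrite /Lp_on => fL gL.
have -> : (fun x => f x + g x) \_ D = f \_ D + g \_ D.
  apply/funext => x; rewrite /= fctE !patchE; case: ifPn => //= _.
  by rewrite addr0.
have L2 : (1 <= 2%:E :> \bar R)%E by rewrite lee_fin ler1n.
exact: (Lfun_addr_closed _ L2).2.
Qed.

Lemma Lp_onN (p : \bar R) f : Lp_on mu p D f -> Lp_on mu p D (fun x => - f x).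
Proof.
rewrite /Lp_on => fL.
have -> : (fun x => - f x) \_ D = - (f \_ D).
  apply/funext => x; rewrite /= fctE !patchE; case: ifPn => //= _.
  by rewrite oppr0.
exact: Lfun_oppr_closed.
Qed.

Lemma Lp_on20 : Lp_on mu 2%:E D (cst 0).
Proof.
apply/Lp_on2P; split => //.
rewrite (_ : _ \o _ = cst 0%E); first exact: integrable0.
by apply/funext => x /=; rewrite expr0n.
Qed.

Lemma Lp_on2_sum (I : Type) (s : seq I) (F : I -> T -> R) :
  (forall i, Lp_on mu 2%:E D (F i)) ->
  Lp_on mu 2%:E D (fun x => \sum_(i <- s) F i x).
Proof.
move=> FL; elim: s => [|i s ih].
  by under eq_fun do rewrite big_nil; exact: Lp_on20.
by under eq_fun do rewrite big_cons; exact: Lp_on2D.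
Qed.

Lemma Lp_onoo_ae_bounded f : Lp_on mu +oo%E D f ->
  exists2 M, 0 <= M & \forall x \ae mu, D x -> `|f x| <= M.
Proof.
rewrite /Lp_on inE => /andP[/[!inE]/= mf].
rewrite /finite_norm unlock /Lnorm.
(* For p = +oo the library norm is 0 by convention when mu setT = 0. *)
case: ifPn => [_ foo|muT _]; last first.
  have muT0 : mu setT = 0%E.
    by apply/eqP; rewrite eq_le measure_ge0 andbT leNgt.
  by exists 0 => //; exists setT; split.
(* The essential supremum is not yet known to be a nonnegative real: a real value is truncated below
   at 0, and [-oo] is bounded by 0. *)
have [M M0 fM] : exists2 M : R, 0 <= M &
    (ess_sup mu (abse \o (EFin \o (f \_ D))) <= M%:E)%E.
  case: (ess_sup _ _) foo => [r _|//|_]; last by exists 0; rewrite ?leNye.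
  by exists (maxr r 0); rewrite ?le_max ?lexx ?orbT// lee_fin le_max lexx.
exists M => //; move/ess_supP : fM; apply: filterS => x /=.
by rewrite patchE => + Dx; rewrite mem_set// lee_fin.
Qed.

(** Almost everywhere [(f g)^2 <= M^2 g^2], where [M] is an essential bound of [f]. *)
Lemma Lp_on_mul_oo2 f g : Lp_on mu +oo%E D f -> Lp_on mu 2%:E D g ->
  Lp_on mu 2%:E D (fun x => f x * g x).
Proof.
move=> fL /Lp_on2P[mg ig]; have mf := Lp_on_measurable fL.
have [M M0 fM] := Lp_onoo_ae_bounded fL.
have mfg : measurable_fun D (fun x => f x * g x) by exact: measurable_funM.
apply/Lp_on2P; split=> //; apply/integrableP; split.
  by apply/measurable_EFinP; exact: measurable_funX.
have /integrableP[mMg Mg] := integrableZl mD (M ^+ 2) ig.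
apply: le_lt_trans Mg; apply: ae_ge0_le_integral => //.
- apply: measurableT_comp => //; apply/measurable_EFinP.
  exact: measurable_funX.
- exact: measurableT_comp.
apply: filterS fM => x fM Dx; rewrite /= lee_fin -exprMn !normrX !normrM.
by rewrite ler_pXn2r ?nnegrE// ler_wpM2r// (ger0_norm M0) fM.
Qed.

End Lp_on_theory.

(** * Borel sets and translations for the Lebesgue measure *)

Section cover_measure_theory.
Set Implicit Arguments.
Unset Strict Implicit.
Local Open Scope ereal_scope.
Context (R : realType) (T : pointedType) (zeta : set T -> \bar R).
Hypothesis zeta_ge0 : forall X, X !=set0 -> 0 <= zeta X.

Lemma gauge0_neq0 X : X !=set0 -> gauge0 zeta X = zeta X.
Proof.
move=> X0; rewrite /gauge0 asboolF// => XE.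
by move: X0; rewrite XE => -[].
Qed.

(** Cutting a cover of [X] by [H] and by its complement covers the two pieces, and the hypothesis
    can be summed termwise. Caratheodory's criterion for [H] thus only has to be checked on the
    gauge. *)
Lemma cover_measure_split (H : set T) :
  (forall X, gauge0 zeta (X `&` H) + gauge0 zeta (X `\` H) <= gauge0 zeta X) ->
  forall X, cover_measure zeta (X `&` H) + cover_measure zeta (X `\` H) <=
            cover_measure zeta X.
Proof.
move=> split X; apply: le_ereal_inf_tmp => _ [F [_ XF] <-].
have g0 := gauge0_ge0 zeta_ge0.
have cov (G : set T) : cover_measure zeta (X `&` G) <=
    \sum_(k <oo) gauge0 zeta (F k `&` G).
  apply: ereal_inf_lbound; exists (fun k => F k `&` G) => //; split => //.
  by move=> x [/XF[k _ Fkx] Gx]; exists k.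
apply: (le_trans (leeD (cov H) (cov (~` H)))).
by rewrite -nneseriesD//; apply: lee_nneseries => // i; rewrite adde_ge0.
Qed.

(** [X] is covered by itself followed by empty sets, which [gauge0] counts as 0. *)
Lemma cover_measure_le_gauge0 X : cover_measure zeta X <= gauge0 zeta X.
Proof.
apply: ereal_inf_lbound; exists (fun k => if k is 0%N then X else set0).
  by split => // x Xx; exists 0%N.
rewrite (nneseries_split 0%N 1%N); last by move=> *; exact: gauge0_ge0.
rewrite big_nat1 eseries0 ?adde0// => -[//|i] _ _.
exact: gauge0_set0.
Qed.

End cover_measure_theory.

(** * Caratheodory measurability of half-spaces, boxes and open sets *)

Section leb_measurable.
Set Implicit Arguments.
Unset Strict Implicit.
Local Open Scope ereal_scope.
Context (R : realType) (d : nat).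
Implicit Types (X : set 'cV[R]_d) (a b : 'cV[R]_d).

Definition box a b : set 'cV[R]_d :=
  [set x | forall i, (a i 0 <= x i 0 <= b i 0)%R].

Lemma box_gauge_box_le X a b : (forall i, a i 0 <= b i 0)%R -> X `<=` box a b ->
  box_gauge X <= (\prod_(i < d) (b i 0 - a i 0)%R)%:E.
Proof. by move=> ab Xab; apply: ereal_inf_lbound; exists (a, b). Qed.

(** The hyperplane [x_i = t] cuts a box around [X] into two boxes whose volumes add up. If one part
    of [X] is empty, its gauge is 0 and the other part is all of [X]. *)
Lemma box_gauge0_split (i : 'I_d) (t : R) X :
  gauge0 (@box_gauge R d) (X `&` [set x : 'cV[R]_d | (x i 0 <= t)%R]) +
  gauge0 (@box_gauge R d) (X `\` [set x : 'cV[R]_d | (x i 0 <= t)%R]) <=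
  gauge0 (@box_gauge R d) X.
Proof.
set H := [set x : 'cV[R]_d | (x i 0 <= t)%R].
have [[x [Xx Hx]]|/nonemptyPn XH0] := pselect (X `&` H !=set0); last first.
  rewrite XH0 gauge0_set0 add0e (_ : X `\` H = X)//.
  apply/seteqP; split=> [x []//|x Xx]; split=> // Hx.
  by have : (X `&` H) x by []; rewrite XH0.
have [[y [Xy Hy]]|/nonemptyPn XH0] := pselect (X `\` H !=set0); last first.
  rewrite XH0 gauge0_set0 adde0 (_ : X `&` H = X)//.
  apply/seteqP; split=> [z []//|z Xz]; split=> //; apply: contrapT => Hz.
  by have : (X `\` H) z by []; rewrite XH0.
rewrite !gauge0_neq0; [|by exists x|by exists y|by exists x].
apply: le_ereal_inf_tmp => _ [[a b] /= [ab Xab] <-].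
(* Points of [X] on both sides of the hyperplane force [a_i <= t <= b_i], so both half-boxes have
   ordered corners. *)
have ait : (a i 0 <= t)%R by apply: le_trans Hx; have /andP[] := Xab _ Xx i.
have tbi : (t <= b i 0)%R.
  move/negP : Hy; rewrite -ltNge => /ltW/le_trans; apply.
  by have /andP[] := Xab _ Xy i.
pose b' : 'cV[R]_d := \col_j (if j == i then t else b j 0)%R.
pose a' : 'cV[R]_d := \col_j (if j == i then t else a j 0)%R.
have H1 : box_gauge (X `&` H) <= (\prod_(j < d) (b' j 0 - a j 0)%R)%:E.
  apply: box_gauge_box_le => [j|z [Xz Hz] j]; rewrite !mxE;
    case: eqP => [->|_]//.
    by rewrite Hz andbT; have /andP[] := Xab _ Xz i.
  exact: Xab.
have H2 : box_gauge (X `\` H) <= (\prod_(j < d) (b j 0 - a' j 0)%R)%:E.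
  apply: box_gauge_box_le => [j|z [Xz Hz] j]; rewrite !mxE;
    case: eqP => [->|_]//.
    move/negP : Hz; rewrite -ltNge => /ltW ->.
    by have /andP[] := Xab _ Xz i.
  exact: Xab.
apply: le_trans (leeD H1 H2) _; rewrite -EFinD lee_fin.
(* Only the [i]-th side changes, so its factor is split off; the two cut sides then satisfy
   [(t - a_i) + (b_i - t) = b_i - a_i]. *)
have prodE (u v : 'cV[R]_d) :
    (forall j, j != i -> u j 0 = a j 0 /\ v j 0 = b j 0)%R ->
    (\prod_(j < d) (v j 0 - u j 0) =
     (v i 0 - u i 0) * \prod_(j < d | j != i) (b j 0 - a j 0))%R.
  move=> uv; rewrite (bigD1 i)//=; congr (_ * _)%R.
  by apply: eq_bigr => j /uv[-> ->].
rewrite (prodE a b')%R; last by move=> j /negbTE ji; rewrite mxE ji.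
rewrite (prodE a' b)%R; last by move=> j /negbTE ji; rewrite mxE ji.
rewrite [leRHS](prodE a b)%R//.
by rewrite !mxE eqxx -mulrDl addrC subrKA.
Qed.

Local Notation mT := (caratheodory_type (@leb_outer R d)).

Lemma measurable_half_space (i : 'I_d) (t : R) :
  measurable ([set x : 'cV[R]_d | (x i 0 <= t)%R] : set mT).
Proof.
apply: (@le_caratheodory_measurable _ _ (@leb_outer R d)) => X.
apply: cover_measure_split; first exact: box_gauge_ge0.
exact: box_gauge0_split.
Qed.

Lemma measurable_coord (i : 'I_d) :
  measurable_fun setT ((fun x : 'cV[R]_d => x i 0%R) : mT -> R).
Proof.
apply: (measurability _ (RGenOInfty.measurableE R)).
move=> /= _ [_ [a ->]] <-; rewrite setTI.
rewrite [X in measurable X](_ : _ = ~` [set x : 'cV[R]_d | (x i 0 <= a)%R]).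
  exact/measurableC/measurable_half_space.
by apply/seteqP; split => x /=; rewrite in_itv/= andbT ltNge => /negP.
Qed.

Lemma measurable_open_box a b :
  measurable ([set x : 'cV[R]_d |
    forall i, (a i 0 < x i 0 < b i 0)%R] : set mT).
Proof.
rewrite [X in measurable X](_ : _ =
    \bigcap_(i in [set: 'I_d])
      ((fun x : 'cV[R]_d => x i 0%R) @^-1` `]a i 0%R, b i 0%R[ : set mT)).
  apply: fin_bigcap_measurable => // i _.
  rewrite -[X in measurable X]setTI.
  by apply: measurable_coord => //; exact: measurable_itv.
apply/seteqP; split => x /= xab i; last by have := xab i I; rewrite /= in_itv.
by rewrite /= in_itv/=.
Qed.

(** An open set is a countable union of open boxes with rational corners, because the balls of the
    sup norm are themselves boxes. *)
Lemma measurable_open (U : set 'cV[R]_d) : open U -> measurable (U : set mT).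
Proof.
move=> oU.
pose B (ab : 'cV[rat]_d * 'cV[rat]_d) : set mT :=
  [set x : 'cV[R]_d | forall i, (ratr (ab.1 i 0) < x i 0 < ratr (ab.2 i 0))%R].
rewrite [X in measurable X](_ : _ =
    \bigcup_ab (if `[< B ab `<=` U >] then B ab else set0)); last first.
  apply/seteqP; split => [x Ux|x [ab _]]; last first.
    by case: ifPn => // /asboolP; exact.
  have /nbhs_ballP[e /= e0 xeU] : nbhs x U by exact: open_nbhs_nbhs.
  have ltxe (i : 'I_d) : (x i 0 - e < x i 0)%R by rewrite ltrBlDr ltrDl.
  have ltxe' (i : 'I_d) : (x i 0 < x i 0 + e)%R by rewrite ltrDl.
  (* Rational corners within [e] below and above each coordinate of [x] give a box that contains [x]
     and lies in the ball of radius [e]. *)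
  have [a aP] := choice (fun i => rat_in_itvoo (ltxe i)).
  have [b bP] := choice (fun i => rat_in_itvoo (ltxe' i)).
  exists (\col_i a i, \col_i b i) => //.
  rewrite asboolT /B /=.
    move=> i; rewrite !mxE; move: (aP i) (bP i); rewrite !in_itv/=.
    by move=> /andP[_ ->] /andP[-> _].
  move=> y yab; apply: xeU; split => // i j; rewrite (ord1 j).
  move: (aP i) (bP i) (yab i); rewrite !mxE !in_itv/=.
  move=> /andP[a1 a2] /andP[b1 b2] /andP[y1 y2].
  rewrite /ball /= ltr_distlC; apply/andP; split.
    exact: lt_trans a1 y1.
  exact: lt_trans y2 b2.
apply: countable_bigcupT_measurable => [|ab]; first exact: countableP.
case: ifP => // _.
rewrite [X in measurable X](_ : _ = [set x : 'cV[R]_d | forall i,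
   ((map_mx ratr ab.1 : 'cV[R]_d) i 0 < x i 0 <
    (map_mx ratr ab.2 : 'cV[R]_d) i 0)%R]).
  exact: measurable_open_box.
by apply/seteqP; split => x xab i; have := xab i; rewrite !mxE.
Qed.

Lemma measurable_continuous (f : 'cV[R]_d -> R) : continuous f ->
  measurable_fun setT (f : mT -> R).
Proof.
move=> cf; apply: (measurability _ (RGenOInfty.measurableE R)).
move=> /= _ [_ [a ->]] <-; rewrite setTI; apply: measurable_open.
by apply: open_comp => [x _|]; [exact: cf|exact: interval_open].
Qed.

Lemma leb_box_lty a b : leb R d (box a b) < +oo.
Proof.
have [/forallP ab|/forallPn[i Hi]] := boolP [forall i, (a i 0 <= b i 0)%R].
  apply: le_lt_trans (cover_measure_le_gauge0 (@box_gauge_ge0 R d) _) _.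
  rewrite gauge0_neq0; last by exists a => i; rewrite lexx ab.
  apply: (le_lt_trans (box_gauge_box_le ab (@subset_refl _ _))).
  by rewrite ltry.
rewrite (_ : box a b = set0) ?measure0//.
apply/seteqP; split => // x /(_ i) /andP[/le_trans/[apply]].
by rewrite (negbTE Hi).
Qed.

End leb_measurable.

(** * Translation invariance of the Lebesgue measure and integral *)

Section leb_translation.
Set Implicit Arguments.
Unset Strict Implicit.
Context (R : realType) (d : nat).
Implicit Types (X : set 'cV[R]_d) (a b v : 'cV[R]_d).
Local Notation mT := (caratheodory_type (@leb_outer R d)).

(** Shifting both corners of a box by [- v] keeps its side lengths. *)
Lemma gauge0_translate v X :
  (gauge0 (@box_gauge R d) ((fun x => (x + v)%R) @^-1` X) <=
   gauge0 (@box_gauge R d) X)%E.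
Proof.
have [X0|/nonemptyPn ->] := pselect (X !=set0); last first.
  by rewrite preimage_set0 gauge0_set0.
have X0' : (fun x => x + v) @^-1` X !=set0.
  by case: X0 => x Xx; exists (x - v); rewrite /= subrK.
rewrite !gauge0_neq0//; apply: le_ereal_inf_tmp => _ [[a b] /= [ab Xab] <-].
apply: (@le_trans _ _ (\prod_(i < d) ((b - v) i 0 - (a - v) i 0))%:E);
  last first.
  rewrite lee_fin le_eqVlt; apply/orP; left; apply/eqP.
  by apply: eq_bigr => i _; rewrite !mxE; ring.
apply: box_gauge_box_le => [i|x /= /Xab xab i]; first by rewrite !mxE lerD2r.
by have := xab i; rewrite !mxE lerBlDr lerBrDr.
Qed.

Lemma leb_outer_translate v X :
  leb_outer ((fun x => x + v) @^-1` X) = leb_outer X.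
Proof.
(* One inequality for all shifts suffices: the reverse one is the shift by [- v] applied to the
   preimage. *)
suff le (w : 'cV[R]_d) (Y : set 'cV[R]_d) :
    (leb_outer ((fun x => (x + w)%R) @^-1` Y) <= leb_outer Y)%E.
  apply/eqP; rewrite eq_le le/=.
  have := le (- v) ((fun x => x + v) @^-1` X).
  rewrite -comp_preimage (_ : _ \o _ = id)//.
  by apply/funext => x /=; rewrite subrK.
apply: le_ereal_inf_tmp => _ [F [_ YF] <-].
apply: (@le_trans _ _ (\sum_(k <oo)
  gauge0 (@box_gauge R d) ((fun x => (x + w)%R) @^-1` F k))%E).
  apply: ereal_inf_lbound; exists (fun k => (fun x => x + w) @^-1` F k) => //.
  by split => // x /YF[k _ Fkx]; exists k.
apply: lee_nneseries => [i _ _|i _]; last exact: gauge0_translate.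
exact: (gauge0_ge0 (@box_gauge_ge0 R d)).
Qed.

Lemma measurable_translate v :
  measurable_fun setT ((fun x : 'cV[R]_d => x + v) : mT -> mT).
Proof.
move=> _ Y mY; rewrite setTI.
suff : caratheodory_measurable (@leb_outer R d)
  ((fun x => x + v) @^-1` Y) by [].
move=> Z; pose h (x : 'cV[R]_d) := x + v.
(* The test set is itself written as a preimage under the translation, so the three outer measures
   in Caratheodory's criterion become those for [Y] tested against [Z']. *)
have -> : Z = h @^-1` ((fun x => x - v) @^-1` Z).
  by apply/seteqP; split => x; rewrite /h /= addrK.
set Z' := _ @^-1` Z.
rewrite -[_ @^-1` Y]/(h @^-1` Y) preimage_setC -!preimage_setI.
rewrite (leb_outer_translate v Z') (leb_outer_translate v (Z' `&` Y)).
rewrite (leb_outer_translate v (Z' `&` ~` Y)).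
exact: mY.
Qed.

(** The pushforward of [leb] under a translation is [leb] again, so this is the change of variables
    formula for pushforwards. *)
Lemma integral_translate v (f : 'cV[R]_d -> \bar R) :
  measurable_fun setT (f : mT -> \bar R) -> (leb R d).-integrable setT f ->
  (\int[leb R d]_x f (x + v)%R = \int[leb R d]_x f x)%E.
Proof.
move=> mf intf.
pose phi : mT -> mT := fun x : 'cV[R]_d => x + v.
have mphi : measurable_fun setT phi by exact: measurable_translate.
pose mphi' := isMeasurableFun.Build _ _ _ _ _ mphi.
pose phi' : {mfun mT >-> mT} := MeasurableFun.Pack (MeasurableFun.Class mphi').
have E (g : mT -> \bar R) :
    (\int[pushforward (leb R d) phi']_x g x = \int[leb R d]_x g x)%E.
  by apply: eq_measure_integral => A mA _; exact: leb_outer_translate.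
(* Integrability of the translate comes from the nonnegative change of variables, applied to the
   absolute value of [f]. *)
have iphi : (leb R d).-integrable setT (f \o phi').
  apply/integrableP; split; first exact: measurableT_comp.
  have /integrableP[_] := intf; apply: le_lt_trans.
  have mabs : measurable_fun setT ((fun x => `|f x|%E) : mT -> \bar R).
    exact: measurableT_comp.
  rewrite -[leRHS](E (fun x => `|f x|%E)).
  by rewrite (ge0_integral_pushforward mphi (leb R d) measurableT mabs).
by rewrite -(E f) integral_pushforward.
Qed.

End leb_translation.

(** * Integrals of derivatives of compactly supported functions *)

Section compact_support.
Set Implicit Arguments.
Unset Strict Implicit.
Context (R : realType) (d : nat).
Implicit Types (X K : set 'cV[R]_d) (a b v : 'cV[R]_d) (f g : 'cV[R]_d -> R).
Local Notation mT := (caratheodory_type (@leb_outer R d)).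
Local Notation cube N := (box (const_mx (- N)) (const_mx N : 'cV[R]_d)).

Lemma norm_coord_le a (i : 'I_d) : `|a i 0| <= `|a|.
Proof.
rewrite [leRHS]/normr /= mx_normrE.
by apply/bigmax_geP; right => /=; exists (i, 0).
Qed.

Lemma bounded_sub_cube X : bounded_set X -> exists2 N, 0 <= N & X `<=` cube N.
Proof.
move=> [M [_ XM]]; exists (`|M| + 1); first by rewrite addr_ge0.
move=> x Xx i; rewrite !mxE -ler_norml (le_trans (norm_coord_le x i))//.
by apply: XM => //; rewrite (le_lt_trans (ler_norm M))// ltrDl.
Qed.

Lemma continuous_translate v : continuous (fun x : 'cV[R]_d => x + v).
Proof.
move=> x; have idx : (fun y : 'cV[R]_d => y) @ x --> x by [].
exact: (cvgD idx (cvg_cst v)).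
Qed.

Lemma continuous_compact_support_bounded K f : compact K -> continuous f ->
  (forall x, ~ K x -> f x = 0) -> exists2 M, 0 <= M & forall x, `|f x| <= M.
Proof.
move=> cK cf f0.
have /compact_bounded[M [_ fM]] : compact (f @` K).
  by apply: continuous_compact => //; exact: continuous_subspaceT.
exists (`|M| + 1) => [|x]; first by rewrite addr_ge0.
have [Kx|/f0 ->] := pselect (K x); last by rewrite normr0 addr_ge0.
by apply: fM; [rewrite (le_lt_trans (ler_norm M))// ltrDl|exists x].
Qed.

Lemma measurable_box a b : measurable (box a b : set mT).
Proof.
rewrite [X in measurable X](_ : _ =
    \bigcap_(i in [set: 'I_d])
      ((fun x : 'cV[R]_d => x i 0) @^-1` `[a i 0, b i 0] : set mT)).
  apply: fin_bigcap_measurable => // i _.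
  rewrite -[X in measurable X]setTI.
  by apply: measurable_coord => //; exact: measurable_itv.
apply/seteqP; split => x /= xab i; last by have := xab i I; rewrite /= in_itv.
by move=> _; rewrite /= in_itv/=; exact: xab.
Qed.

Lemma integrable_box_cst a b (M : R) :
  (leb R d).-integrable setT ((cst M%:E) \_ (box a b)).
Proof.
apply/(integrable_mkcond _ (measurable_box a b)).
apply: measurable_bounded_integrable.
- exact: measurable_box.
- exact: leb_box_lty.
- exact: measurable_cst.
- by exists `|M|; split => // r Mr x _ /=; exact: ltW.
Qed.

(** A constant on a cube containing [K], extended by 0, dominates [f], and cubes have finite
    measure. *)
Lemma integrable_continuous_compact_support K f : compact K -> continuous f ->
  (forall x, ~ K x -> f x = 0) -> (leb R d).-integrable setT (EFin \o f).
Proof.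
move=> cK cf f0.
have [M M0 fM] := continuous_compact_support_bounded cK cf f0.
have [N N0 KN] := bounded_sub_cube (compact_bounded cK).
apply: (le_integrable measurableT _ _
  (integrable_box_cst (const_mx (- N)) (const_mx N) M)).
  by apply/measurable_EFinP; exact: measurable_continuous.
move=> x _ /=; rewrite patchE; case: ifPn => [_|xN].
  by rewrite /= lee_fin (ger0_norm M0).
rewrite f0 ?normr0 ?abse_ge0// => /KN xK.
by move/negP : xN; apply; rewrite inE.
Qed.

(** The difference quotients of both derivatives are the same function; this makes the one-variable
    mean value theorem available along a line. *)
Lemma is_derive_line f x v (t : R) : derivable f (t *: v + x) v ->
  is_derive t 1 (fun s => f (s *: v + x)) ('D_v f (t *: v + x)).
Proof.
have E : (fun h : R => h^-1 *:
      (((fun s => f (s *: v + x)) \o shift t) (h *: 1) - f (t *: v + x))) =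
    (fun h : R => h^-1 *:
      ((f \o shift (t *: v + x)) (h *: v) - f (t *: v + x))).
  apply/funext => h /=; congr (_ *: (f _ - _)).
  by rewrite [h *: 1]mulr1 scalerDl addrA.
by move=> df; apply: DeriveDef; rewrite /derivable /derive E.
Qed.

(** The complement of [K] is open, so near a point outside [K] the function coincides with the
    constant 0. *)
Lemma derive_support K f v : closed K -> (forall x, ~ K x -> f x = 0) ->
  forall x, ~ K x -> 'D_v f x = 0.
Proof.
move=> cK f0 x Kx; rewrite -(derive_cst (0 : R) x v); apply: near_eq_derive.
have : nbhs x (~` K) by apply: open_nbhs_nbhs; split => //; exact: closed_openC.
by apply: filterS => y Ky; exact: f0.
Qed.

(** Dominated convergence applies to the difference quotients: the mean value theorem bounds them by
    a bound of ['D_v f], and they all vanish outside one fixed cube. *)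
Lemma integral_derive_eq0 K f v : compact K -> continuous f ->
  (forall x, ~ K x -> f x = 0) -> (forall x, derivable f x v) ->
  continuous ('D_v f) -> \int[leb R d]_x ('D_v f x) = 0.
Proof.
move=> cK cf f0 df cDf.
have clK : closed K by apply: compact_closed => //; exact: norm_hausdorff.
have Df0 := derive_support v clK f0.
have [M M0 DfM] := continuous_compact_support_bounded cK cDf Df0.
have [N N0 KN] := bounded_sub_cube (compact_bounded cK).
have mf := measurable_continuous cf.
(* Increments of at most 1 keep the shifted supports inside the cube enlarged by the norm of [v]. *)
pose t (n : nat) : R := n.+1%:R^-1.
have t0 n : 0 < t n by rewrite invr_gt0.
have t1 n : t n <= 1 by rewrite invf_le1 ?ler1n.
pose h n x : R := (t n)^-1 * (f (x + t n *: v) - f x).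
have if_ : (leb R d).-integrable setT (EFin \o f).
  exact: integrable_continuous_compact_support f0.
have ctr n : continuous (fun x : 'cV[R]_d => f (x + t n *: v)).
  move=> x.
  apply: (@continuous_comp _ _ _ (fun x : 'cV[R]_d => x + t n *: v) f).
    exact: continuous_translate.
  exact: cf.
have ch n : continuous (h n).
  by move=> x; exact: (cvgM (cvg_cst _) (cvgB (ctr n x) (cf x))).
have iftr n : (leb R d).-integrable setT
    (EFin \o (fun x : 'cV[R]_d => f (x + t n *: v))).
  pose K' := (fun x : 'cV[R]_d => x - t n *: v) @` K.
  apply: (@integrable_continuous_compact_support K') => [||x K'x].
  - apply: continuous_compact => //; apply: continuous_subspaceT.
    exact: continuous_translate.
  - exact: ctr.
  - by apply: f0 => Kx; apply: K'x; exists (x + t n *: v) => //; rewrite addrK.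
(* Both terms of the quotient have the same integral by translation invariance, and it is finite, so
   the extended-real difference is 0. *)
have Ih n : (\int[leb R d]_x (h n x)%:E = 0)%E.
  under eq_integral do rewrite /h EFinM EFinB.
  have iB := integrableB measurableT (iftr n) if_.
  rewrite (integralZl measurableT iB) (integralB measurableT (iftr n) if_).
  have mEf : measurable_fun setT (EFin \o f : mT -> \bar R).
    exact/measurable_EFinP.
  rewrite [X in (_ * (X - _))%E](integral_translate (t n *: v) mEf if_).
  by rewrite subee ?mule0//; exact: integrable_fin_num.
have hM n x : (`|(h n x)%:E| <= ((cst M%:E) \_ (cube (N + `|v|)%R)) x)%E.
  rewrite patchE; case: ifPn => [_|xN].
    (* By the mean value theorem on [[0, t n]], the quotient is a value of ['D_v f] at an
       intermediate point. *)
    have [c _ fc] : exists2 c, c \in `]0, (t n)[ &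
        f (t n *: v + x) - f (0 *: v + x) = 'D_v f (c *: v + x) * (t n - 0).
      apply: (@MVT _ (fun s => f (s *: v + x)) (fun c => 'D_v f (c *: v + x))).
      - exact: t0.
      - by move=> s _; exact: is_derive_line.
      apply: continuous_subspaceT => s.
      have := is_derive_line (df (s *: v + x)).
      by move=> [/derivable1_diffP/differentiable_continuous].
    rewrite scale0r add0r subr0 (addrC (t n *: v)) in fc.
    rewrite /h fc mulrC -mulrA divff ?gt_eqF// mulr1 lee_fin.
    exact: DfM.
  (* Outside the enlarged cube, neither [x] nor [x + t n *: v] meets [K], so the quotient is 0. *)
  have Kx : ~ K x.
    move=> /KN xK; move/negP : xN; apply; rewrite inE => i.
    have := xK i; rewrite !mxE => /andP[x1 x2].
    by rewrite !opprD lerBlDr !ler_wpDr.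
  have Kxt : ~ K (x + t n *: v).
    move=> /KN xK; move/negP : xN; apply; rewrite inE => i.
    have := xK i; rewrite !mxE => /andP[x1 x2].
    have tv : `|t n * v i 0| <= `|v|.
      rewrite normrM gtr0_norm//.
      apply: le_trans (norm_coord_le v i).
      by rewrite ler_piMl.
    move: tv; rewrite ler_norml => /andP[v1 v2].
    apply/andP; split; lra.
  by rewrite /h !f0// subrr mulr0 abse0.
(* The derivative is a limit over nonzero increments, hence the punctured filter; [t n] is never
   0. *)
have tcvg : t @ \oo --> 0^'.
  move=> A A0; have := @cvg_harmonic R _ A0.
  by move=> [k _ kA]; exists k => // n /kA; apply; rewrite gt_eqF.
have cvh x : h ^~ x @ \oo --> 'D_v f x.
  rewrite (_ : h ^~ x =
      (fun r : R => r^-1 *: ((f \o shift x) (r *: v) - f x)) \o t).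
    exact: cvg_comp tcvg (df x).
  by apply/funext => n; rewrite /h /= [t n *: v + x]addrC.
have mEh n : measurable_fun setT (EFin \o h n : mT -> \bar R).
  by apply/measurable_EFinP; exact: measurable_continuous.
have mEf : measurable_fun setT (EFin \o 'D_v f : mT -> \bar R).
  by apply/measurable_EFinP; exact: measurable_continuous.
have cvEh : {ae leb R d, forall x, setT x ->
    (EFin \o h n) x @[n --> \oo] --> (EFin \o 'D_v f) x}.
  by apply: aeW => x _; apply: cvg_EFin; [exact: nearW|exact: cvh].
have hMae : {ae leb R d, forall x n, setT x ->
    (`|(EFin \o h n) x| <= ((cst M%:E) \_ (cube (N + `|v|)%R)) x)%E}.
  by apply: aeW => x n _; exact: hM.
have [_ _] := dominated_convergence measurableT mEh mEf cvEh
  (integrable_box_cst _ _ _) hMae.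
rewrite (_ : (fun n => _) = cst 0%E); last by apply/funext => n; exact: Ih.
move=> /(cvg_lim (@ereal_hausdorff R)); rewrite lim_cst// /Rintegral => <-.
by [].
Qed.

End compact_support.

(** * Test functions as elements of H^1 with zero trace *)

Section test_functions.
Set Implicit Arguments.
Unset Strict Implicit.
Context (R : realType) (d : nat) (Omega : set 'cV[R]_d).
Hypothesis oOmega : open Omega.
Implicit Types (f phi psi : 'cV[R]_d -> R).
Local Notation mT := (caratheodory_type (@leb_outer R d)).

Let mOmega : measurable (Omega : set mT) := measurable_open oOmega.

Lemma compact_support_L2 (K : set 'cV[R]_d) f : compact K -> continuous f ->
  (forall x, ~ K x -> f x = 0) -> L2_scalar Omega f.
Proof.
move=> cK cf f0; apply/(Lp_on2P _ mOmega); split.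
  exact: (measurable_funTS (measurable_continuous cf)).
apply: (integrableS measurableT mOmega) => //.
apply: (integrable_continuous_compact_support cK) => [|x Kx].
  by move=> x; exact: (cvgM (cf x) (cf x)).
by rewrite f0// expr0n.
Qed.

Lemma Rintegral_support f : (forall x, ~ Omega x -> f x = 0) ->
  \int[leb R d]_(x in Omega) f x = \int[leb R d]_x f x.
Proof.
move=> f0; rewrite Rintegral_mkcond; congr Rintegral.
apply/funext => x; rewrite patchE; case: ifPn => // xO.
by rewrite f0// => Ox; rewrite mem_set in xO.
Qed.

Lemma support_eq0 f x : ~ closure [set y | f y != 0] x -> f x = 0.
Proof.
move=> Kx; apply/eqP/negPn/negP => fx; apply: Kx.
exact: subset_closure.
Qed.

Lemma partial_support_eq0 f i x :
  ~ closure [set y | f y != 0] x -> partial i f x = 0.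
Proof.
move: x; apply: derive_support => [|x]; first exact: closed_closure.
exact: support_eq0.
Qed.

Lemma test_function_continuous phi : test_function Omega phi -> continuous phi.
Proof. by move=> [/(_ 0%N)]. Qed.

Lemma test_function_derivable phi i x : test_function Omega phi ->
  derivable phi x (delta_mx i 0).
Proof. by move=> [/(_ 1%N)[_ /(_ i)[]]]. Qed.

Lemma test_function_partial_continuous phi i : test_function Omega phi ->
  continuous (partial i phi).
Proof. by move=> [/(_ 1%N)[_ /(_ i)[]]]. Qed.

Lemma test_function_L2 phi : test_function Omega phi -> L2_scalar Omega phi.
Proof.
move=> tphi; have [_ cK _] := tphi; apply: (compact_support_L2 cK).
  exact: test_function_continuous.
exact: support_eq0.
Qed.

Lemma test_function_gradient_L2 phi : test_function Omega phi ->
  L2_vector Omega (gradient phi).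
Proof.
move=> tphi i; have [_ cK _] := tphi.
rewrite (_ : (fun x => _) = partial i phi); last first.
  by apply/funext => x; rewrite mxE.
apply: (compact_support_L2 cK).
  exact: test_function_partial_continuous.
exact: partial_support_eq0.
Qed.

(** The product [phi * psi] has compact support, so the integral of its [i]-th partial derivative
    vanishes; Leibniz' rule turns this into integration by parts. *)
Lemma test_function_weak_gradient phi : test_function Omega phi ->
  weak_gradient Omega phi (gradient phi).
Proof.
move=> tphi psi tpsi i; under [X in - X]eq_Rintegral do rewrite mxE.
have [_ cK KO] := tphi.
have phi0 := @support_eq0 phi.
have Dphi0 := @partial_support_eq0 phi i.
have cphi := test_function_continuous tphi.
have cpsi := test_function_continuous tpsi.
have cDphi : continuous (partial i phi).
  exact: test_function_partial_continuous.
have cDpsi : continuous (partial i psi).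
  exact: test_function_partial_continuous.
have dphi x : derivable phi x (delta_mx i 0) by exact: test_function_derivable.
have dpsi x : derivable psi x (delta_mx i 0) by exact: test_function_derivable.
(* The support of [phi] lies in [Omega], so both integrals may be taken over the whole space, where
   translations act. *)
rewrite Rintegral_support; last by move=> x Ox; rewrite phi0 ?mul0r// => /KO.
rewrite Rintegral_support; last by move=> x Ox; rewrite Dphi0 ?mul0r// => /KO.
have i1 : (leb R d).-integrable setT
    (EFin \o (fun x => phi x * partial i psi x)).
  apply: (integrable_continuous_compact_support cK) => x.
    exact: (cvgM (cphi x) (cDpsi x)).
  by move=> /phi0 ->; rewrite mul0r.
have i2 : (leb R d).-integrable setT
    (EFin \o (fun x => partial i phi x * psi x)).
  apply: (integrable_continuous_compact_support cK) => x.
    exact: (cvgM (cDphi x) (cpsi x)).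
  by move=> /Dphi0 ->; rewrite mul0r.
apply/eqP; rewrite -addr_eq0 -RintegralD//; apply/eqP.
have DE : 'D_(delta_mx i 0) (phi * psi) =
    (fun x => phi x * partial i psi x + partial i phi x * psi x).
  apply/funext => x; rewrite deriveM//.
  by rewrite [psi x *: _]mulrC.
rewrite -DE; apply: (integral_derive_eq0 cK).
- by move=> x; exact: (cvgM (cphi x) (cpsi x)).
- by move=> x /phi0 phix; rewrite fctE phix mul0r.
- by move=> x; exact: derivableM.
- rewrite DE => x.
  exact: (cvgD (cvgM (cphi x) (cDpsi x)) (cvgM (cDphi x) (cpsi x))).
Qed.

Definition test_H1 phi (tphi : test_function Omega phi) : H1 Omega :=
  MkH1 (test_function_L2 tphi) (test_function_gradient_L2 tphi)
    (test_function_weak_gradient tphi).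

(** The constant sequence [phi] serves as the smooth approximation. It vanishes on the boundary
    because its support lies in [Omega], which is open and so contains none of its boundary
    points. *)
Lemma test_H1_trace phi (tphi : test_function Omega phi) :
  is_trace (test_H1 tphi) (cst 0).
Proof.
split.
  rewrite /Lp_on (_ : _ \_ _ = 0).
    apply: (Lfun_addr_closed _ _).1.
    by rewrite lee_fin ler1n.
  by apply/funext => x; rewrite patchE; case: ifP.
exists (fun=> phi); split.
- by move=> _; have [] := tphi.
- rewrite (_ : (fun n : nat => _) = cst 0%E); first exact: cvg_cst.
  apply/funext => n; apply: integral0_eq => x _ /=.
  rewrite !subrr expr0n add0r /dotv big1// => i _.
  by rewrite mxE mul0r.
- rewrite (_ : (fun n : nat => _) = cst 0%E); first exact: cvg_cst.
  apply/funext => n; apply: integral0_eq => x [_ Ox] /=.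
  rewrite support_eq0 ?subrr ?expr0n//.
  have [_ _ KO] := tphi; apply: contra_not Ox => /KO Ox.
  exact: open_nbhs_nbhs.
Qed.

Definition test_H1t phi (tphi : test_function Omega phi) : H1t Omega :=
  MkH1t (test_H1_trace tphi).

End test_functions.

(** * The variational identity *)

Section green.
Set Implicit Arguments.
Unset Strict Implicit.
Context (R : realType) (d : nat) (Omega : set 'cV[R]_d).
Hypothesis oOmega : open Omega.
Local Notation mT := (caratheodory_type (@leb_outer R d)).
Let mOmega : measurable (Omega : set mT) := measurable_open oOmega.

Lemma L2_dotv_integrable (u w : 'cV[R]_d -> 'cV[R]_d) :
  L2_vector Omega u -> L2_vector Omega w ->
  (leb R d).-integrable Omega (EFin \o (fun x => dotv (u x) (w x))).
Proof.
move=> uL wL; rewrite (_ : EFin \o _ =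
    fun x => (\sum_(i < d) (u x i 0%R * w x i 0%R)%:E)%E); last first.
  by apply/funext => x; rewrite /dotv /= sumEFin.
apply: (integrable_sum mOmega) => i _.
exact: (Lp_on2_mul_integrable mOmega (uL i) (wL i)).
Qed.

(** In [a(s, z)] the matrix acts on the gradient of [s], in the flux on that of [z]; this moves it
    across. *)
Lemma dotv_trmx_mulmx (M : 'M[R]_d) (u w : 'cV[R]_d) :
  dotv (M *m u) w = dotv (M^T *m w) u.
Proof.
have E (a e : 'cV[R]_d) : dotv a e = (a^T *m e) 0 0.
  by rewrite mxE; apply: eq_bigr => i _; rewrite mxE.
have C (a e : 'cV[R]_d) : dotv a e = dotv e a.
  by apply: eq_bigr => i _; rewrite mulrC.
by rewrite (C (M^T *m w)) !E trmx_mul mulmxA.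
Qed.

Variables (A : 'cV[R]_d -> 'M[R]_d) (b : 'cV[R]_d -> 'cV[R]_d)
  (c g1 : 'cV[R]_d -> R) (g2 : 'cV[R]_d -> 'cV[R]_d).
Hypothesis AL : forall i j, Linf_scalar Omega (fun x => A x i j).
Hypothesis Asym : \forall x \ae leb R d, Omega x -> (A x)^T = A x.
Hypothesis bL : forall i, Linf_scalar Omega (fun x => b x i 0).
Hypothesis cL : Linf_scalar Omega c.
Hypothesis g1L : L2_scalar Omega g1.
Hypothesis g2L : L2_vector Omega g2.

Lemma mulmx_L2 (u : 'cV[R]_d -> 'cV[R]_d) : L2_vector Omega u ->
  L2_vector Omega (fun x => A x *m u x).
Proof.
move=> uL i; rewrite /L2_scalar; under eq_fun do rewrite mxE.
apply: (Lp_on2_sum mOmega) => j.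
exact: (Lp_on_mul_oo2 mOmega (AL i j) (uL j)).
Qed.

Lemma adjoint_flux_L2 (z : H1 Omega) : L2_vector Omega (adjoint_flux A b g2 z).
Proof.
move=> i; rewrite /L2_scalar /adjoint_flux; under eq_fun do rewrite !mxE.
apply: Lp_onN; apply: (Lp_on2D _ (g2L i)); apply: Lp_on2D.
  have := mulmx_L2 (H1_gradL2 z) i; rewrite /L2_scalar.
  by under eq_fun do rewrite mxE.
under eq_fun do rewrite mulrC.
exact: (Lp_on_mul_oo2 mOmega (bL i) (H1_L2 z)).
Qed.

(** The equation for [q] is only assumed a.e. so that the identity serves both directions: the
    system provides some such [q], while the converse takes [g1 - c z] itself. *)
Lemma adjoint_green (z s : H1 Omega) (q : 'cV[R]_d -> R) : L2_scalar Omega q ->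
  (fun x => q x + c x * fval z x) = g1 %[ae leb R d in Omega] ->
  \int[leb R d]_(x in Omega) dotv (adjoint_flux A b g2 z x) (fgrad s x) +
  \int[leb R d]_(x in Omega) (q x * fval s x) =
  \int[leb R d]_(x in Omega) (g1 x * fval s x) -
  \int[leb R d]_(x in Omega) dotv (g2 x) (fgrad s x) - form_a A b c s z.
Proof.
move=> qL qE.
have zL := H1_L2 z; have dzL := H1_gradL2 z.
have sL := H1_L2 s; have dsL := H1_gradL2 s.
have i1 := L2_dotv_integrable (adjoint_flux_L2 z) dsL.
have i2 := Lp_on2_mul_integrable mOmega qL sL.
have i3 := Lp_on2_mul_integrable mOmega g1L sL.
have i4 := L2_dotv_integrable g2L dsL.
have i5 := L2_dotv_integrable (mulmx_L2 dsL) dzL.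
have i6 : (leb R d).-integrable Omega (EFin \o
    (fun x => (dotv (b x) (fgrad s x) + c x * fval s x) * fval z x)).
  apply: (Lp_on2_mul_integrable mOmega _ zL); apply: Lp_on2D.
    apply: (Lp_on2_sum mOmega) => i.
    exact: (Lp_on_mul_oo2 mOmega (bL i) (dsL i)).
  exact: (Lp_on_mul_oo2 mOmega cL sL).
have i12 := integrableD mOmega i1 i2.
have i34 := integrableB mOmega i3 i4.
have i56 := integrableD mOmega i5 i6.
rewrite /form_a.
(* Each side is merged into a single integral, which leaves an a.e. identity between integrands. *)
rewrite -(RintegralD mOmega i1 i2) -(RintegralB mOmega i3 i4).
rewrite -(RintegralD mOmega i5 i6) -(RintegralB mOmega i34 i56).
rewrite /Rintegral; congr fine; apply: ae_eq_integral.
- exact: mOmega.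
- by have /integrableP[] := i12.
- by have /integrableP[] := integrableB mOmega i34 i56.
have aeF := ae_filter_ringOfSetsType (leb R d).
apply: filterS2 Asym qE => x Ax qx Ox; congr (_%:E).
(* Here [g1] becomes [q + c z], whose term [c z s] cancels the one in the form. *)
move/(_ Ox) : Ax => Ax; move/(_ Ox) : qx => <-.
rewrite (dotv_trmx_mulmx (A x)) Ax /adjoint_flux.
have -> : dotv (- (A x *m fgrad z x + fval z x *: b x + g2 x)) (fgrad s x) =
    - (dotv (A x *m fgrad z x) (fgrad s x) + fval z x * dotv (b x) (fgrad s x)
       + dotv (g2 x) (fgrad s x)).
  rewrite /dotv mulr_sumr -!big_split/= -sumrN; apply: eq_bigr => i _.
  by rewrite !mxE; ring.
ring.
Qed.

End green.

(** * Equivalence of the adjoint weak problem and the adjoint first-order system *)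

Theorem lemma3p2 (R : realType) (d : nat) (hd : (2 <= d)%N)
  (Omega GammaD GammaN : set 'cV[R]_d)
  (hOmega : bounded_lipschitz_domain Omega)
  (hGamma : boundary_partition Omega GammaD GammaN)
  (hGammaD : (0 < surf R d GammaD)%E)
  (A : 'cV[R]_d -> 'M[R]_d) (b : 'cV[R]_d -> 'cV[R]_d) (c : 'cV[R]_d -> R)
  (a0 a1 : R) (ha0 : 0 < a0) (ha01 : a0 <= a1)
  (hA : elliptic_coefficient Omega A a0 a1)
  (hb : forall i, Linf_scalar Omega (fun x => b x i 0))
  (hc : Linf_scalar Omega c)
  (g1 : 'cV[R]_d -> R) (hg1 : L2_scalar Omega g1)
  (g2 : 'cV[R]_d -> 'cV[R]_d) (hg2 : L2_vector Omega g2)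
  (psid : 'cV[R]_d -> R) (hpsid : Lp_on (surf R d) 2%:E GammaN psid)
  (phid : 'cV[R]_d -> R) (hphid : Hhalf Omega GammaD phid)
  (beta : R) (hbeta : 0 < beta)
  (hinfsup1 : beta%:E = infsup_fst Omega A b c GammaD)
  (hinfsup2 : beta%:E = infsup_snd Omega A b c GammaD)
  (z : H1t Omega) (hz : trace_eq GammaD z phid) :
  let r := adjoint_flux A b g2 z in
  adjoint_weak_problem A b c GammaD GammaN g1 g2 psid z <->
  adjoint_first_order_system A b c GammaD GammaN g1 g2 psid phid r z.
Proof.
move=> r; have [oO _ _ _] := hOmega; have [AL Asym _] := hA.
have green s q :=
  @adjoint_green _ _ _ oO _ _ _ _ _ AL Asym hb hc hg1 hg2 z s q.
split=> [weak|[q [[_ qL _] [qE _ _ qN]]] s0 s0D]; last first.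
  (* The normal trace condition replaces the left side of the identity by the boundary term of [m];
     solving for [a(s0, z)] gives [m(s0)]. *)
  have := green s0 q qL qE; rewrite (qN s0 s0D) /form_m; lra.
(* The first equation of the system forces this choice up to null sets. *)
pose q x := g1 x - c x * fval z x.
have qL : L2_scalar Omega q.
  apply: Lp_on2D; first exact: hg1.
  exact/Lp_onN/(Lp_on_mul_oo2 (measurable_open oO) hc (H1_L2 z)).
have qE : (fun x => q x + c x * fval z x) = g1 %[ae leb R d in Omega].
  by apply: aeW => x _; rewrite /q subrK.
(* With [a(s0, z) = m(s0)] the volume terms on the right cancel and only the boundary term
   survives. *)
have flux (s0 : H1t Omega) : H1_D GammaD s0 ->
    \int[leb R d]_(x in Omega) dotv (r x) (fgrad s0 x) +
    \int[leb R d]_(x in Omega) (q x * fval s0 x) =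
    \int[surf R d]_(x in GammaN) (psid x * trace s0 x).
  move=> s0D; have := green s0 q qL qE.
  by rewrite (weak s0 s0D) /form_m /r => ->; ring.
exists q; split; last split=> //.
- split=> // [|phi tphi].
    exact: (adjoint_flux_L2 oO AL hb hg2).
  (* A test function has trace 0, so it is admissible in [flux] with zero boundary term; what
     remains is the weak divergence identity. *)
  have phiD : H1_D GammaD (test_H1t oO tphi) by apply: aeW.
  have /= := flux _ phiD.
  rewrite [RHS](_ : _ = 0); first by move/eqP; rewrite addr_eq0 => /eqP.
  under eq_Rintegral do rewrite mulr0.
  by rewrite /Rintegral integral0.
- apply: aeW => x _; rewrite /r /adjoint_flux -[LHS]addrA opprD addrAC.
  by rewrite addNr add0r.
Qed.
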